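(* For every integer $r \ge 3$: (i) $\mathrm{OPT}_r(P_3) = 12\left(\frac{r-1}{r}\right)^3$; (ii) $P_3$ is $K_{r+1}$-Turán-good, i.e. there exists $n_0 = n_0(r)$ such that for all $n \ge n_0$, $\mathrm{ex}(n,P_3,K_{r+1}) = \nu(P_3,T_r(n))$.
   Context: All graphs are finite and simple. $P_\ell$ denotes the path with $\ell$ edges (and $\ell+1$ vertices); so $P_3$ is the path on 4 vertices. $K_{r+1}$ is the complete graph on $r+1$ vertices; a graph is $K_{r+1}$-free if it contains no (not necessarily induced) subgraph isomorphic to $K_{r+1}$. For graphs $T,G$, $\nu(T,G)$ is the number of distinct (not necessarily induced) subgraphs of $G$ isomorphic to $T$, and the density is $d(T,G) = \nu(T,G)\binom{|V(G)|}{|V(T)|}^{-1}$. $\mathrm{ex}(n,T,F)$ is the maximum of $\nu(T,G)$ over all $F$-free graphs $G$ on $n$ vertices. The Turán graph $T_r(n)$ is the complete $r$-partite graph on $n$ vertices whose parts have sizes $\lfloor n/r\rfloor$ or $\lceil n/r\rceil$. Letting $\mathcal{F}_{n,r}$ be the family of $K_{r+1}$-free graphs on $n$ vertices, $\mathrm{OPT}_r(P_3) = \lim_{n\to\infty} \max_{G \in \mathcal{F}_{n,r}} d(P_3,G)$. *)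

(* Defs.v *)
From HB Require Import structures.
From mathcomp Require Import all_boot all_order all_algebra.
From mathcomp Require Import reals topology normedtype sequences.

Set Implicit Arguments.
Unset Strict Implicit.
Unset Printing Implicit Defensive.

Import Order.TTheory GRing.Theory Num.Theory.
Import numFieldNormedType.Exports.

Record sgraph (V : finType) := SGraph {
  edges :> {set {set V}};
  edges_card2 : [forall e in edges, #|e| == 2] }.

HB.instance Definition _ (V : finType) := [isSub for @edges V].
#[hnf] HB.instance Definition _ (V : finType) := [Finite of sgraph V by <:].

(* {x, y} is an edge iff x != y and (e x y or e y x): the relation e need not
   be symmetric or irreflexive. *)
Definition edges_of_rel (V : finType) (e : rel V) : {set {set V}} :=
  [set a | [exists x, exists y, [&& x != y, e x y & a == [set x; y]]]].

Lemma edges_of_rel_card2 (V : finType) (e : rel V) :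
  [forall a in edges_of_rel e, #|a| == 2].
Proof.
apply/forall_inP => a; rewrite inE.
by case/existsP=> x /existsP[y /and3P[xy _ /eqP->]]; rewrite cards2 xy.
Qed.

Definition sgraph_of_rel (V : finType) (e : rel V) : sgraph V :=
  SGraph (edges_of_rel_card2 e).

Lemma sgraph_of_relE (V : finType) (e : rel V) (x y : V) :
  ([set x; y] \in edges (sgraph_of_rel e)) = (x != y) && (e x y || e y x).
Proof.
rewrite inE; apply/existsP/andP => [[u /existsP[v]]|[xy /orP[exy|eyx]]]; last 2 first.
- by exists x; apply/existsP; exists y; rewrite xy exy eqxx.
- by exists y; apply/existsP; exists x; rewrite eq_sym xy eyx setUC eqxx.
case/and3P=> uv euv /eqP E.
have : (x \in [set u; v]) && (y \in [set u; v]) by rewrite -E !inE !eqxx orbT.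
have : (u \in [set x; y]) && (v \in [set x; y]) by rewrite E !inE !eqxx orbT.
rewrite !inE.
case: (eqVneq x y) => [<-|xy].
  by rewrite !orbb => /andP[/eqP ux /eqP vx]; rewrite ux vx eqxx in uv.
move=> _ /andP[/orP[]/eqP xE /orP[]/eqP yE]; subst; rewrite ?euv ?orbT //;
  by rewrite eqxx in xy.
Qed.

Definition pathg (l : nat) : sgraph 'I_l.+1 :=
  sgraph_of_rel [rel x y : 'I_l.+1 | y == x.+1 :> nat].

Definition completeg (m : nat) : sgraph 'I_m :=
  sgraph_of_rel [rel x y : 'I_m | true].

(* The parts are the residue classes modulo r; see card_turan_part. *)
Definition turang (r n : nat) : sgraph 'I_n :=
  sgraph_of_rel [rel x y : 'I_n | x != y %[mod r]].

Lemma card_turan_part (r n k : nat) : k < r ->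
  #|[set x : 'I_n | x == k %[mod r]]| = n %/ r + (k < n %% r).
Proof.
move=> kr; have r0 : 0 < r by apply: leq_ltn_trans kr.
rewrite cardsE -sum1_card big_mkcond /=.
rewrite -(big_mkord xpredT (fun x => if x == k %[mod r] then 1 else 0)).
rewrite (modn_small kr).
elim: n => [|n IH]; first by rewrite big_geq // div0n mod0n.
rewrite big_nat_recr //= IH divnS // modnS.
have := ltn_pmod n r0; have := divn_eq n r; set q := n %/ r; set s := n %% r.
move=> nE sr; have -> : (r %| n.+1) = (s.+1 == r).
  rewrite nE -addnS dvdn_addr ?dvdn_mull //.
  by apply/idP/eqP => [/dvdn_leq h|->//]; apply/eqP; rewrite eqn_leq sr h.
case: (eqVneq s.+1 r) => [sE|sE] /=.
  have ks : k <= s by rewrite -ltnS sE.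
  have -> : (k < s) = (s != k) by rewrite ltn_neqAle eq_sym ks andbT.
  by case: (s == k); rewrite /= ?addn0 ?addn1 ?add1n.
rewrite add0n -addnA; congr (_ + _).
rewrite ltnS (leq_eqVlt k s) (eq_sym k).
by case: (eqVneq s k) => [->|_]; rewrite ?ltnn ?addn0.
Qed.

(* A subgraph is a pair (vertex set, edge set). *)
Definition is_subgraph (V : finType) (G : sgraph V)
    (S : {set V} * {set {set V}}) : bool :=
  (S.2 \subset edges G) && [forall e in S.2, e \subset S.1].

Definition is_copy (VT V : finType) (T : sgraph VT)
    (S : {set V} * {set {set V}}) : bool :=
  [exists f : {ffun VT -> V},
     [&& injectiveb f, f @: [set: VT] == S.1
       & [set f @: (e : {set VT}) | e in edges T] == S.2]].

Definition copies (VT V : finType) (T : sgraph VT) (G : sgraph V) :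
    {set {set V} * {set {set V}}} :=
  [set S | is_subgraph G S && is_copy T S].

Definition nu (VT V : finType) (T : sgraph VT) (G : sgraph V) : nat :=
  #|copies T G|.

Definition subgraph_free (VF V : finType) (F : sgraph VF) (G : sgraph V) : bool :=
  copies F G == set0.

Definition ex_count (n : nat) (VT VF : finType) (T : sgraph VT) (F : sgraph VF) : nat :=
  \max_(G : sgraph 'I_n | subgraph_free F G) nu T G.

Local Open Scope ring_scope.

Definition density (R : realType) (VT V : finType)
    (T : sgraph VT) (G : sgraph V) : R :=
  (nu T G)%:R / 'C(#|V|, #|VT|)%:R.

(* Densities are nonnegative and the edgeless graph is K_{r+1}-free for r > 0,
   so the default value 0 does not affect the maximum. *)
Definition max_density (R : realType) (r : nat) (VT : finType)
    (T : sgraph VT) (n : nat) : R :=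
  \big[Num.max/0]_(G : sgraph 'I_n | subgraph_free (completeg r.+1) G) density R T G.

Definition OPT (R : realType) (r : nat) (VT : finType) (T : sgraph VT) : R :=
  limn (max_density R r T).

Definition turan_good (r : nat) (VT : finType) (T : sgraph VT) : Prop :=
  exists n0 : nat, forall n : nat, (n0 <= n)%N ->
    ex_count n T (completeg r.+1) = nu T (turang r n).

(* Main.v *)
Require Import Defs.
From HB Require Import structures.
From mathcomp Require Import classical_sets.
From mathcomp Require Import all_boot all_order all_algebra.
From mathcomp Require Import reals topology normedtype sequences.
From mathcomp Require Import zify ring lra.

Set Implicit Arguments.
Unset Strict Implicit.
Unset Printing Implicit Defensive.

Import Order.TTheory GRing.Theory Num.Theory.
Import numFieldNormedType.Exports.
Local Open Scope ring_scope.

(** The extremal inequality holds for every n. Adding edges one may assume that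
    the K_{r+1}-free graph contains an r-clique K (or is complete, if it has
    fewer than r vertices); let A be the set of the other vertices. A vertex of
    A has at most r-1 neighbours in K, and two vertices of A have at most r-1
    common neighbours in K, at most r-2 if they are adjacent. The number of
    paths meeting K is a polynomial in these degrees and codegrees, the vertex
    degrees inside A and the edges of A; it increases when the degrees and
    codegrees are replaced by the above bounds, and then only depends on
    the size of A, its number of edges and its number of 2-edge paths, with
    nonnegative coefficients. In the Turan graph with r consecutive vertices in
    the role of K all these bounds are equalities, so induction on the number
    of vertices compares edges, 2-edge paths and 3-edge paths simultaneously.
    The limit density is then that of the Turan graph, all of whose degrees are
    within 1 of (1 - 1/r) n. *)

(** * Ordered path counts in a vertex set *)

Section PathCounts.
Variable V : finType.
Implicit Types (e : rel V) (W A K : {set V}) (x y z w : V).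

Definition clique e K := {in K &, forall x y, x != y -> e x y}.

(* Ordered counts: every edge and every path is counted once per orientation. *)
Definition edge2 e W : int := \sum_(x in W) \sum_(y in W) (e x y)%:R.

Definition path2 e W : int :=
  \sum_(x in W) \sum_(y in W) \sum_(z in W) [&& e x y, e y z & x != z]%:R.

Definition path3 e W : int :=
  \sum_(x in W) \sum_(y in W) \sum_(z in W) \sum_(w in W)
    [&& e x y, e y z, e z w, x != z, x != w & y != w]%:R.

Definition deg e W x : int := \sum_(y in W) (e x y)%:R.

Definition codeg e W x y : int := \sum_(z in W) (e x z)%:R * (e y z)%:R.

Lemma sum2D (W A : {set V}) (F G : V -> V -> int) :
  \sum_(x in W) \sum_(y in A) (F x y + G x y) =
  \sum_(x in W) \sum_(y in A) F x y + \sum_(x in W) \sum_(y in A) G x y.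
Proof. by rewrite -big_split; apply: eq_bigr => x _; rewrite -big_split. Qed.

Lemma sum2Z (W A : {set V}) c (F : V -> V -> int) :
  \sum_(x in W) \sum_(y in A) c * F x y = c * \sum_(x in W) \sum_(y in A) F x y.
Proof. by rewrite mulr_sumr; apply: eq_bigr => x _; rewrite mulr_sumr. Qed.

Lemma eq_sum2 (W A : {set V}) (F G : V -> V -> int) :
  (forall x y, x \in W -> y \in A -> F x y = G x y) ->
  \sum_(x in W) \sum_(y in A) F x y = \sum_(x in W) \sum_(y in A) G x y.
Proof. by move=> FG; apply: eq_bigr => x ?; apply: eq_bigr => y ?; apply: FG. Qed.

Lemma ler_sum2 (W A : {set V}) (F G : V -> V -> int) :
  (forall x y, x \in W -> y \in A -> F x y <= G x y) ->
  \sum_(x in W) \sum_(y in A) F x y <= \sum_(x in W) \sum_(y in A) G x y.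
Proof. by move=> FG; apply: ler_sum => x ?; apply: ler_sum => y ?; apply: FG. Qed.

Lemma sum_pred1 W x (F : V -> int) : x \in W ->
  \sum_(y in W) F y * (y == x)%:R = F x.
Proof.
move=> xW; rewrite (bigD1 x) //= eqxx mulr1 big1 ?addr0 // => y /andP[_ /negPf->].
by rewrite mulr0.
Qed.

Lemma sum_predC1 W x (F : V -> int) : x \in W ->
  \sum_(y in W) F y * (y != x)%:R = \sum_(y in W) F y - F x.
Proof.
move=> xW; rewrite -(sum_pred1 F xW) -sumrB; apply: eq_bigr => y _.
by case: (y == x); rewrite ?mulr0 ?mulr1 ?subrr ?subr0.
Qed.

(** Choose the middle vertex first: the two ends are then an ordered pair of distinct neighbours of
    it. *)
Lemma path2E e W : symmetric e ->
  path2 e W = \sum_(x in W) (deg e W x * deg e W x - deg e W x).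
Proof.
move=> se; rewrite /path2 exchange_big; apply: eq_bigr => y yW /=.
rewrite {1 3}/deg mulr_suml -sumrB; apply: eq_bigr => x xW.
rewrite (eq_bigr (fun z => (e y x)%:R * (e y z)%:R * (z != x)%:R)); last first.
  by move=> z _; rewrite eq_sym (se x y); case: (e y x); case: (e y z); case: (z == x).
rewrite (sum_predC1 (fun z => (e y x)%:R * (e y z)%:R)) // -mulr_sumr -/(deg e W y).
by case: (e y x); rewrite ?mul1r ?mul0r ?subrr.
Qed.

(** Choose the oriented middle edge, then one further neighbour of each of its ends. The codegree
    discards the choices where the two outer vertices coincide and close a triangle. *)
Lemma path3E e W : symmetric e -> irreflexive e ->
  path3 e W =
  \sum_(x in W) \sum_(y in W) (e x y)%:R * ((deg e W x - 1) * (deg e W y - 1)) -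
  \sum_(x in W) \sum_(y in W) (e x y)%:R * codeg e W x y.
Proof.
move=> se ie; rewrite /path3 exchange_big -sumrB; apply: eq_bigr => y yW /=.
rewrite exchange_big -sumrB; apply: eq_bigr => z zW /=.
have [eyz|eyz] := boolP (e y z); last first.
  rewrite !mul0r subrr big1 // => x _; rewrite big1 // => w _.
  by rewrite andbF.
rewrite !mul1r.
have degB (u v : V) : v \in W -> e u v ->
    deg e W u - 1 = \sum_(x in W) (e u x)%:R * (x != v)%:R.
  by move=> vW euv; rewrite (sum_predC1 (fun x => (e u x)%:R)) // euv.
rewrite (degB y z) // (degB z y) 1?se // mulr_suml -sumrB.
apply: eq_bigr => x xW.
(* The codegree term is spread over [w] with the indicator of [w == x], so that the two sides can be
   compared term by term. *)
rewrite mulr_sumr -[X in _ = _ - X](sum_pred1 (fun=> (e y x)%:R * (e z x)%:R) xW) -sumrB.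
apply: eq_bigr => w wW; rewrite (se x y) (eq_sym w y).
have [->|wx] := eqVneq w x; last by rewrite mulr0 subr0; case: (e y x);
  case: (x == z); case: (e z w);
  case: (y == w).
rewrite !andbF; have [->|_] := eqVneq x z; first by rewrite ie !(mulr0n, mulr0, mul0r) ?subr0.
have [->|_] := eqVneq y x; first by rewrite ie !(mulr0n, mulr0, mul0r) ?subr0.
by rewrite !mulr1 subrr.
Qed.

Lemma edge2_mono e e' W : subrel e e' -> edge2 e W <= edge2 e' W.
Proof.
move=> ee'; apply: ler_sum2 => x y _ _; rewrite ler_nat.
by case: (boolP (e x y)) => // /ee' ->.
Qed.

Lemma path2_mono e e' W : subrel e e' -> path2 e W <= path2 e' W.
Proof.
move=> ee'; apply: ler_sum2 => x y _ _; apply: ler_sum => z _; rewrite ler_nat.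
by case: and3P => // -[/ee'-> /ee'-> ->].
Qed.

Lemma path3_mono e e' W : subrel e e' -> path3 e W <= path3 e' W.
Proof.
move=> ee'; apply: ler_sum2 => x y _ _; apply: ler_sum2 => z w _ _; rewrite ler_nat.
case: (boolP [&& e x y, _, _, _, _ & _]) => //.
by case/and5P => /ee'-> /ee'-> /ee'-> -> /andP[-> ->].
Qed.

End PathCounts.

(** * Splitting off a clique *)

Section CliqueSplit.
Variables (V : finType) (e : rel V) (A K : {set V}).
Hypotheses (se : symmetric e) (ie : irreflexive e).
Hypotheses (dAK : [disjoint A & K]) (cK : clique e K).

Let a x := deg e K x.
Let d x := deg e A x.
Let c x y := codeg e K x y.
Let r : int := #|K|%:R.

Lemma big_setU_disjoint (F : V -> int) :
  \sum_(x in A :|: K) F x = \sum_(x in A) F x + \sum_(x in K) F x.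
Proof. by rewrite -bigU //; apply: eq_bigl => x; rewrite !inE. Qed.

Lemma big_setU_disjoint2 (F : V -> V -> int) : (forall x y, F x y = F y x) ->
  \sum_(x in A :|: K) \sum_(y in A :|: K) F x y =
  \sum_(x in A) \sum_(y in A) F x y + 2 * (\sum_(x in A) \sum_(y in K) F x y)
  + \sum_(x in K) \sum_(y in K) F x y.
Proof.
move=> sF; under eq_bigr do rewrite big_setU_disjoint.
rewrite big_setU_disjoint !big_split /=.
have -> : \sum_(i in K) \sum_(j in A) F i j = \sum_(i in A) \sum_(j in K) F i j.
  by rewrite exchange_big; apply: eq_sum2.
by ring.
Qed.

Lemma degU x : deg e (A :|: K) x = d x + a x.
Proof. exact: big_setU_disjoint. Qed.

Lemma codegU x y : codeg e (A :|: K) x y = codeg e A x y + c x y.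
Proof. exact: big_setU_disjoint. Qed.

Lemma sum_card (k : int) : \sum_(x in K) k = r * k.
Proof. by rewrite sumr_const -mulr_natl. Qed.

Lemma sum_clique x (F : V -> int) : x \in K ->
  \sum_(y in K) (e x y)%:R * F y = \sum_(y in K) F y - F x.
Proof.
move=> xK; rewrite -(sum_predC1 F xK); apply: eq_bigr => y yK.
have [->|xy] := eqVneq y x; first by rewrite ie mul0r mulr0.
by rewrite cK // 1?eq_sym // mul1r mulr1.
Qed.

Lemma deg_clique x : x \in K -> a x = r - 1.
Proof.
move=> xK; have := sum_clique (fun=> 1) xK.
by rewrite sum_card mulr1 => <-; apply: eq_bigr => y _; rewrite mulr1.
Qed.

(** Double counting of the edges between [A] and [K], each weighted by its end in [K]. This and the
    next lemmas turn sums over [K] into sums over [A]. *)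
Lemma sum_deg_swap (F : V -> int) :
  \sum_(k in K) d k * F k = \sum_(x in A) \sum_(k in K) (e x k)%:R * F k.
Proof.
rewrite exchange_big; apply: eq_bigr => k _; rewrite -mulr_suml; congr (_ * _).
by apply: eq_bigr => x _; rewrite se.
Qed.

Lemma sum_deg : \sum_(k in K) d k = \sum_(x in A) a x.
Proof.
rewrite (eq_bigr (fun k => d k * 1)); last by move=> k _; rewrite mulr1.
by rewrite sum_deg_swap; apply: eq_sum2 => x y _ _; rewrite mulr1.
Qed.

Lemma sum_adj_deg x : \sum_(k in K) (e x k)%:R * d k = \sum_(y in A) c y x.
Proof.
rewrite exchange_big; apply: eq_bigr => k _; rewrite mulr_sumr.
by apply: eq_bigr => y _; rewrite (se k y) mulrC.
Qed.

(** Both sides count ordered pairs of edges from [A] that share their end in [K]. *)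
Lemma sum_deg_sqr : \sum_(k in K) d k * d k = \sum_(x in A) \sum_(y in A) c x y.
Proof.
rewrite sum_deg_swap exchange_big; under eq_bigr do rewrite -mulr_suml.
rewrite [RHS]exchange_big /=.
rewrite -(eq_bigr _ (fun x _ => sum_adj_deg x)) exchange_big; apply: eq_bigr => k _.
by rewrite mulr_suml.
Qed.

(** Both sides count ordered pairs of distinct neighbours of [x] in [K]; these are adjacent to each
    other because [K] is a clique. *)
Lemma sum_codeg_adj x : \sum_(k in K) (e x k)%:R * codeg e K x k = a x * a x - a x.
Proof.
rewrite {1 3}/a /deg mulr_suml -sumrB; apply: eq_bigr => k kK.
have -> : codeg e K x k = \sum_(l in K) (e k l)%:R * (e x l)%:R.
  by apply: eq_bigr => l _; rewrite mulrC.
by rewrite sum_clique // -/(deg e K x); case: (e x k); rewrite ?mul1r ?mul0r ?subrr.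
Qed.

Lemma edge2_split : edge2 e (A :|: K) =
  edge2 e A + 2 * (\sum_(x in A) a x) + r * (r - 1).
Proof.
rewrite /edge2 big_setU_disjoint2; last by move=> x y; rewrite se.
by congr (_ + _); rewrite -sum_card; apply: eq_bigr => x /deg_clique.
Qed.

Lemma path2_split : path2 e (A :|: K) = path2 e A
  + \sum_(x in A) \sum_(y in A) (c x y + 2 * ((e x y)%:R * a x))
  + \sum_(x in A) (a x * a x + (2 * r - 4) * a x) + r * (r - 1) * (r - 2).
Proof.
rewrite !path2E // big_setU_disjoint.
rewrite (eq_bigr (fun x => (d x * d x - d x) + 2 * (d x * a x) + a x * a x - a x));
  last by move=> x _; rewrite degU; ring.
rewrite [X in _ + X = _](eq_bigr (fun x => d x * d x + (2 * r - 3) * d x + (r - 1) * (r - 2)));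
  last by move=> x /deg_clique xK; rewrite degU xK; ring.
rewrite sumrB !big_split /= -!mulr_sumr sum_deg sum_deg_sqr sum_card.
rewrite sum2D sum2Z.
have -> : \sum_(x in A) \sum_(y in A) (e x y)%:R * a x = \sum_(x in A) d x * a x.
  by apply: eq_bigr => x _; rewrite -mulr_suml.
by rewrite /d; ring.
Qed.

(** [path3E] is applied to [A :|: K] and to [A], and the middle edges are sorted by how many of
    their ends lie in [K]. Degrees of clique vertices are then eliminated by double counting, which
    leaves only quantities indexed by [A]. *)
Lemma path3_split : path3 e (A :|: K) = path3 e A
  + \sum_(x in A) \sum_(y in A)
     ((e x y)%:R * (a x * a y + 2 * a x * (d y - 1) + 2 * (r - 2) * a y - 3 * c x y)
      + c x y * (2 * (d y + a y) - 3) + a x * a y)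
  + \sum_(x in A) ((2 * r - 7) * (a x * a x - a x) + 2 * (r - 2) * (r - 1) * a x)
  + r * (r - 1) * (r - 2) * (r - 3).
Proof.
rewrite !path3E //.
set E := fun x y => (e x y)%:R : int.
have codegC W x y : codeg e W x y = codeg e W y x.
  by apply: eq_bigr => z _; rewrite mulrC.
rewrite !big_setU_disjoint2; first last.
- by move=> x y; rewrite se; congr (_ * _); rewrite mulrC.
- by move=> x y; rewrite se codegC.
(* [S1], [S2], [S3] treat the product of degrees in [path3E], and [T1], [T2], [T3] the triangle
   correction, for middle edges inside [A], between [A] and [K], and inside [K]. *)
have S1 : \sum_(x in A) \sum_(y in A)
      E x y * ((deg e (A :|: K) x - 1) * (deg e (A :|: K) y - 1))
  = \sum_(x in A) \sum_(y in A) E x y * ((d x - 1) * (d y - 1))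
    + \sum_(x in A) \sum_(y in A) E x y * (a x * a y)
    + 2 * \sum_(x in A) \sum_(y in A) E x y * (a x * (d y - 1)).
  have -> : 2 * \sum_(x in A) \sum_(y in A) E x y * (a x * (d y - 1)) =
      \sum_(x in A) \sum_(y in A) E x y * (a x * (d y - 1)) +
      \sum_(x in A) \sum_(y in A) E x y * (a y * (d x - 1)).
    rewrite [X in _ + X]exchange_big mulr_natl mulr2n; congr (_ + _).
    by apply: eq_sum2 => x y _ _; rewrite /E se.
  by rewrite -!sum2D; apply: eq_sum2 => x y _ _; rewrite !degU; ring.
have S2 : \sum_(x in A) \sum_(y in K)
      E x y * ((deg e (A :|: K) x - 1) * (deg e (A :|: K) y - 1))
  = \sum_(x in A) \sum_(y in A) c x y * (d y + a y - 1)
    + (r - 2) * \sum_(x in A) \sum_(y in A) E x y * a y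
    + (r - 2) * \sum_(x in A) (a x * a x - a x).
  rewrite [X in X + _ + _]exchange_big [X in _ + _ * X + _]exchange_big.
  rewrite !mulr_sumr -!big_split /=; apply: eq_bigr => x _.
  rewrite -!mulr_suml -sum_adj_deg.
  have -> : \sum_(y in A) E y x = d x by apply: eq_bigr => y _; rewrite /E se.
  rewrite (eq_bigr (fun k => (d x + a x - 1) * (E x k * d k) +
    (d x + a x - 1) * (r - 2) * E x k)); last first.
    by move=> k /deg_clique kK; rewrite !degU kK; ring.
  rewrite big_split /= -!mulr_sumr.
  by have -> : \sum_(k in K) E x k = a x by []; rewrite /E; ring.
have S3 : \sum_(x in K) \sum_(y in K)
      E x y * ((deg e (A :|: K) x - 1) * (deg e (A :|: K) y - 1))
  = \sum_(x in A) \sum_(y in A) a x * a y - \sum_(x in A) \sum_(y in A) c x y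
    + 2 * (r - 2) * (r - 1) * \sum_(x in A) a x + r * (r - 1) * (r - 2) * (r - 2).
  have DK k : k \in K -> deg e (A :|: K) k - 1 = d k + (r - 2).
    by move=> /deg_clique kK; rewrite degU kK; ring.
  (* All pairs of distinct vertices of [K] are adjacent, so the sum is the square of the total of
     [d k + (r - 2)] minus the sum of the squares. *)
  rewrite (eq_bigr (fun k => (d k + (r - 2)) * (\sum_(x in A) a x + r * (r - 2)) -
     (d k + (r - 2)) * (d k + (r - 2)))); last first.
    move=> k kK; rewrite -mulrBr -sum_deg -sum_card -big_split /=.
    rewrite -(sum_clique (fun x => d x + (r - 2))) // mulr_sumr.
    by apply: eq_bigr => l lK; rewrite !DK // /E; ring.
  rewrite sumrB -mulr_suml big_split /= sum_card sum_deg.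
  rewrite [X in _ - X](eq_bigr (fun k => d k * d k + 2 * (r - 2) * d k + (r - 2) * (r - 2)));
    last by move=> k _; ring.
  rewrite !big_split /= -mulr_sumr sum_deg sum_deg_sqr sum_card.
  have -> : \sum_(x in A) \sum_(y in A) a x * a y = (\sum_(x in A) a x) * (\sum_(x in A) a x).
    by rewrite mulr_suml; apply: eq_bigr => x _; rewrite mulr_sumr.
  by ring.
have T1 : \sum_(x in A) \sum_(y in A) E x y * codeg e (A :|: K) x y =
   \sum_(x in A) \sum_(y in A) E x y * codeg e A x y +
   \sum_(x in A) \sum_(y in A) E x y * c x y.
  by rewrite -sum2D; apply: eq_sum2 => x y _ _; rewrite codegU mulrDr.
have T2 : \sum_(x in A) \sum_(y in K) E x y * codeg e (A :|: K) x y =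
   \sum_(x in A) \sum_(y in A) E x y * c x y + \sum_(x in A) (a x * a x - a x).
  rewrite -big_split; apply: eq_bigr => x _ /=.
  rewrite -sum_codeg_adj.
  under eq_bigr do rewrite codegU mulrDr.
  rewrite big_split /=; congr (_ + _).
  under eq_bigr do rewrite mulr_sumr.
  rewrite exchange_big; apply: eq_bigr => y _ /=; rewrite mulr_sumr.
  by apply: eq_bigr => k _; rewrite /E (se k y); ring.
have T3 : \sum_(x in K) \sum_(y in K) E x y * codeg e (A :|: K) x y =
   \sum_(x in A) (a x * a x - a x) + r * (r - 1) * (r - 2).
  under eq_sum2 do rewrite codegU mulrDr.
  rewrite sum2D; congr (_ + _); last first.
    rewrite -mulrA -sum_card; apply: eq_bigr => x xK.
    by rewrite sum_codeg_adj deg_clique //; ring.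
  (* Triangles with exactly two vertices in [K] are counted from their third vertex, which lies in
     [A]. *)
  rewrite -(eq_bigr _ (fun x _ => sum_codeg_adj x)).
  rewrite exchange_big.
  under eq_bigr => k _.
    under eq_bigr => l _ do rewrite mulr_sumr.
    rewrite exchange_big; over.
  rewrite exchange_big; apply: eq_bigr => x _ /=; apply: eq_bigr => k kK.
  rewrite mulr_sumr; apply: eq_bigr => l lK.
  by rewrite /E (se l k) (se l x) (se k x); ring.
rewrite S1 S2 S3 T1 T2 T3.
set s1 := \sum_(x in A) \sum_(y in A) E x y * ((d x - 1) * (d y - 1)).
set s2 := \sum_(x in A) \sum_(y in A) E x y * codeg e A x y.
have -> : \sum_(x in A) \sum_(y in A)
     ((e x y)%:R * (a x * a y + 2 * a x * (d y - 1) + 2 * (r - 2) * a y - 3 * c x y)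
      + c x y * (2 * (d y + a y) - 3) + a x * a y) =
   \sum_(x in A) \sum_(y in A) E x y * (a x * a y) +
   2 * \sum_(x in A) \sum_(y in A) E x y * (a x * (d y - 1)) +
   2 * (r - 2) * \sum_(x in A) \sum_(y in A) E x y * a y +
   -3 * \sum_(x in A) \sum_(y in A) E x y * c x y +
   2 * \sum_(x in A) \sum_(y in A) c x y * (d y + a y - 1) +
   -1 * \sum_(x in A) \sum_(y in A) c x y +
   \sum_(x in A) \sum_(y in A) a x * a y.
  by rewrite -!sum2Z -!sum2D; apply: eq_sum2 => x y _ _; rewrite /E; ring.
have -> : \sum_(x in A) ((2 * r - 7) * (a x * a x - a x) + 2 * (r - 2) * (r - 1) * a x) =
    (2 * r - 7) * \sum_(x in A) (a x * a x - a x) +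
    2 * (r - 2) * (r - 1) * \sum_(x in A) a x.
  by rewrite big_split /= -!mulr_sumr.
by rewrite -/s1 -/s2; ring.
Qed.

End CliqueSplit.

(** * Bounds for paths meeting the clique *)

(* The counts after adding an r-clique to N vertices carrying M, P, Q ordered
   edges, 2-edge paths and 3-edge paths, when all degree bounds are attained. *)
Definition edge2_step (r N M : int) : int := M + 2 * (N * (r - 1)) + r * (r - 1).

Definition path2_step (r N M P : int) : int :=
  P + (N * N * (r - 1) + (2 * r - 3) * M)
  + N * ((r - 1) * (r - 1) + (2 * r - 4) * (r - 1)) + r * (r - 1) * (r - 2).

Definition path3_step (r N M P Q : int) : int :=
  Q + (2 * (r - 2) * (P + M) + 2 * (r - 1) * (N * M)
       + 3 * (r - 2) * (r - 3) * M + 3 * (r - 1) * (r - 2) * (N * N))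
  + N * ((2 * r - 7) * ((r - 1) * (r - 1) - (r - 1)) + 2 * (r - 2) * (r - 1) * (r - 1))
  + r * (r - 1) * (r - 2) * (r - 3).

(** Exchanging the two indices preserves the double sum, so the terms of [(x, y)] and [(y, x)] may
    be compared together. *)
Lemma ler_sum2_sym (V : finType) (A : {set V}) (F G : V -> V -> int) :
  (forall x y, x \in A -> y \in A -> F x y + F y x <= G x y + G y x) ->
  \sum_(x in A) \sum_(y in A) F x y <= \sum_(x in A) \sum_(y in A) G x y.
Proof.
move=> FG; have dbl (H : V -> V -> int) : 2 * (\sum_(x in A) \sum_(y in A) H x y) =
    \sum_(x in A) \sum_(y in A) (H x y + H y x).
  by rewrite sum2D mulr_natl mulr2n; congr (_ + _); rewrite exchange_big.
by rewrite -(ler_pM2l (_ : 0 < 2)) // !dbl; apply: ler_sum2.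
Qed.

(* The contribution of an ordered pair (x, y) to [path3_split]: [ax], [ay], [c] are
   the degrees and the codegree into the clique, [d] is the degree of y outside
   of it, [E] the adjacency of x and y and [s + 1] the size of the clique. *)
Definition pair_term (s ax ay c d E : int) : int :=
  E * (ax * ay + 2 * ax * (d - 1) + 2 * (s - 1) * ay - 3 * c)
  + c * (2 * (d + ay) - 3) + ax * ay.

Definition vertex_term (s a : int) : int :=
  (2 * s - 5) * (a * a - a) + 2 * (s - 1) * s * a.

(* The coefficient of [c] may be negative in [pair_term], but after
   symmetrization it is at most its value at [ax = ay = s], which is nonnegative. *)
Lemma pair_term_bound0 (s ax ay c dx dy : int) : 2 <= s -> 0 <= c -> 0 <= ax -> 0 <= ay ->
  c <= s -> ax <= s -> ay <= s -> 0 <= dx -> 0 <= dy ->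
  pair_term s ax ay c dy 0 + pair_term s ay ax c dx 0 <=
  pair_term s s s s dy 0 + pair_term s s s s dx 0.
Proof.
rewrite /pair_term => *.
have : ax * ay <= s * s by apply: ler_pM.
have : c * (2 * (dx + dy) + 2 * (ax + ay) - 6) <= c * (2 * (dx + dy) + 4 * s - 6).
  by apply: ler_wpM2l => //; lia.
have : c * (2 * (dx + dy) + 4 * s - 6) <= s * (2 * (dx + dy) + 4 * s - 6).
  by apply: ler_wpM2r => //; lia.
lia.
Qed.

(** For adjacent vertices each degree outside the clique is at least 1. This makes [dx - 1] and
    [dy - 1] nonnegative, and also the factor [2 * (dx + dy) + 4 * s - 12], which vanishes at
    [s = 2], [dx = dy = 1]. *)
Lemma pair_term_bound1 (s ax ay c dx dy : int) : 2 <= s -> 0 <= c -> 0 <= ax -> 0 <= ay ->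
  c <= s - 1 -> ax <= s -> ay <= s -> 1 <= dx -> 1 <= dy ->
  pair_term s ax ay c dy 1 + pair_term s ay ax c dx 1 <=
  pair_term s s s (s - 1) dy 1 + pair_term s s s (s - 1) dx 1.
Proof.
rewrite /pair_term => *.
have : ax * ay <= s * s by apply: ler_pM.
have : c * (2 * (dx + dy) + 2 * (ax + ay) - 12) <= c * (2 * (dx + dy) + 4 * s - 12).
  by apply: ler_wpM2l => //; lia.
have : c * (2 * (dx + dy) + 4 * s - 12) <= (s - 1) * (2 * (dx + dy) + 4 * s - 12).
  by apply: ler_wpM2r => //; lia.
have : ax * (dy - 1) <= s * (dy - 1) by apply: ler_wpM2r => //; lia.
have : ay * (dx - 1) <= s * (dx - 1) by apply: ler_wpM2r => //; lia.
have : (s - 1) * (ax + ay) <= (s - 1) * (s + s) by apply: ler_wpM2l => //; lia.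
lia.
Qed.

Lemma vertex_term_bound (s u : int) : 2 <= s -> 0 <= u -> u <= s ->
  vertex_term s u <= vertex_term s s.
Proof.
move=> s2 u0 us; rewrite -subr_ge0.
(* The coefficient [2 * s - 5] is negative at [s = 2], but there the second factor equals [3 - u],
   which is positive since [u <= 2]. *)
have -> : vertex_term s s - vertex_term s u =
    (s - u) * ((2 * s - 5) * (s + u - 1) + 2 * (s - 1) * s).
  by rewrite /vertex_term; ring.
by apply: mulr_ge0; nia.
Qed.

Section CliqueStep.
Variables (V : finType) (e : rel V) (A K : {set V}).
Hypotheses (se : symmetric e) (ie : irreflexive e).
Hypotheses (dAK : [disjoint A & K]) (cK : clique e K).

Let a x := deg e K x.
Let d x := deg e A x.
Let c x y := codeg e K x y.
Let r : int := #|K|%:R.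
Let E x y : int := (e x y)%:R.
Let N : int := #|A|%:R.

Lemma sum_cardA (k : int) : \sum_(x in A) k = N * k.
Proof. by rewrite sumr_const -mulr_natl. Qed.

Lemma sum2_cardA (k : int) : \sum_(x in A) \sum_(y in A) k = N * N * k.
Proof. by rewrite sum_cardA sum_cardA mulrA. Qed.

(** At the extremal degrees and codegrees only two sums depend on the graph: [d y] over all pairs
    gives [N * edge2 e A], and [d y] over adjacent pairs gives the sum of squared degrees, that is,
    [path2 e A + edge2 e A]. *)
Lemma sum_tight_pairs :
  \sum_(x in A) \sum_(y in A)
    pair_term (r - 1) (r - 1) (r - 1) (r - 1 - E x y) (d y) (E x y) =
  2 * (r - 2) * (path2 e A + edge2 e A) + 2 * (r - 1) * (N * edge2 e A)
       + 3 * (r - 2) * (r - 3) * edge2 e A + 3 * (r - 1) * (r - 2) * (N * N).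
Proof.
have EE x y : E x y * E x y = E x y by rewrite /E; case: (e x y).
have -> : N * edge2 e A = \sum_(x in A) \sum_(y in A) d y by rewrite sum_cardA.
have -> : path2 e A + edge2 e A = \sum_(x in A) \sum_(y in A) E x y * d y.
  rewrite path2E // -big_split exchange_big; apply: eq_bigr => y _ /=.
  by rewrite subrK -mulr_suml; congr (_ * _); apply: eq_bigr => x _; rewrite /E se.
rewrite [_ * (N * N)]mulrC -sum2_cardA /edge2 -/E -!sum2Z -!sum2D.
apply: eq_sum2 => x y _ _; rewrite /pair_term -/(E x y).
(* The square of [E x y] is isolated so that it can be replaced by [E x y], an identity special to
   the values 0 and 1. *)
have -> : forall u v w z : int, E x y * (u + v + w - 3 * (r - 1 - E x y)) + z =
  E x y * (u + v + w - 3 * (r - 1)) + 3 * (E x y * E x y) + z by move=> *; ring.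
by rewrite EE; ring.
Qed.

Lemma sum_tight_codeg :
  \sum_(x in A) \sum_(y in A) (r - 1 - E x y + 2 * (E x y * (r - 1))) =
  N * N * (r - 1) + (2 * r - 3) * edge2 e A.
Proof.
rewrite -sum2_cardA /edge2 -sum2Z -sum2D; apply: eq_sum2 => x y _ _.
by rewrite -/(E x y); ring.
Qed.

Lemma path3_splitE : path3 e (A :|: K) = path3 e A
  + \sum_(x in A) \sum_(y in A) pair_term (r - 1) (a x) (a y) (c x y) (d y) (E x y)
  + \sum_(x in A) vertex_term (r - 1) (a x) + r * (r - 1) * (r - 2) * (r - 3).
Proof.
rewrite path3_split //; congr (_ + _ + _ + _).
  by apply: eq_sum2 => x y _ _; rewrite /pair_term /E /a /d /c /r; ring.
by apply: eq_bigr => x _; rewrite /vertex_term /a /r; ring.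
Qed.

Section Tight.
Hypothesis aE : {in A, forall x, a x = r - 1}.
Hypothesis cE : {in A &, forall x y, c x y = r - 1 - E x y}.

Lemma edge2_tight : edge2 e (A :|: K) = edge2_step r N (edge2 e A).
Proof. by rewrite edge2_split // (eq_bigr _ aE) sum_cardA. Qed.

Lemma path2_tight : path2 e (A :|: K) = path2_step r N (edge2 e A) (path2 e A).
Proof.
rewrite path2_split // /path2_step -sum_tight_codeg -sum_cardA.
congr (_ + _ + _ + _); last by apply: eq_bigr => x /aE; rewrite /a => ->.
by apply: eq_sum2 => x y xA yA; rewrite [codeg _ _ _ _]cE // [deg _ _ _]aE.
Qed.

Lemma path3_tight :
  path3 e (A :|: K) = path3_step r N (edge2 e A) (path2 e A) (path3 e A).
Proof.
rewrite path3_splitE /path3_step -sum_tight_pairs -sum_cardA.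
congr (_ + _ + _ + _).
  by apply: eq_sum2 => x y xA yA; rewrite cE // !aE.
by apply: eq_bigr => x xA; rewrite aE // /vertex_term; ring.
Qed.
End Tight.

Section Bound.
Hypothesis r3 : 3 <= r.
Hypothesis aB : {in A, forall x, a x <= r - 1}.
Hypothesis cB : {in A &, forall x y, c x y <= r - 1 - E x y}.

Lemma deg_ge0 W x : 0 <= deg e W x.
Proof. by apply: sumr_ge0 => y _; rewrite ler0n. Qed.

Lemma codeg_ge0 x y : 0 <= c x y.
Proof. by apply: sumr_ge0 => z _; rewrite mulr_ge0 ?ler0n. Qed.

Lemma codegC x y : c x y = c y x.
Proof. by apply: eq_bigr => z _; rewrite mulrC. Qed.

Lemma codeg_le_deg x y : c x y <= a x.
Proof.
by apply: ler_sum => z _; rewrite -natrM ler_nat; case: (e x z); case: (e y z).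
Qed.

Lemma deg_ge1 x y : y \in A -> e x y -> 1 <= d x.
Proof.
move=> yA exy; rewrite /d /deg (bigD1 y) //= exy lerDl.
by apply: sumr_ge0 => z _; rewrite ler0n.
Qed.

Lemma edge2_bound : edge2 e (A :|: K) <= edge2_step r N (edge2 e A).
Proof.
rewrite edge2_split // /edge2_step -sum_cardA.
have : \sum_(x in A) a x <= \sum_(x in A) (r - 1) by apply: ler_sum => x /aB.
by rewrite /a /r; lia.
Qed.

Lemma path2_bound : path2 e (A :|: K) <= path2_step r N (edge2 e A) (path2 e A).
Proof.
rewrite path2_split // /path2_step -sum_tight_codeg -sum_cardA.
rewrite lerD2r -!addrA lerD2l; apply: lerD.
  apply: ler_sum2 => x y xA yA; apply: lerD; first exact: cB.
  by rewrite ler_pM2l // ler_wpM2l ?ler0n // aB.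
apply: ler_sum => x xA; have := aB xA; have := deg_ge0 K x.
by move: (r3); rewrite -/(a x) -/r; nia.
Qed.

(** Vertex terms are bounded one by one. Pair terms are bounded after symmetrization, separately for
    adjacent and for non-adjacent pairs. *)
Lemma path3_bound :
  path3 e (A :|: K) <= path3_step r N (edge2 e A) (path2 e A) (path3 e A).
Proof.
rewrite path3_splitE /path3_step -sum_tight_pairs -sum_cardA.
have s2 : 2 <= r - 1 by lia.
rewrite lerD2r -!addrA lerD2l; apply: lerD; last first.
  apply: ler_sum => x xA; apply: le_trans (vertex_term_bound s2 (deg_ge0 K x) (aB xA)) _.
  by rewrite /vertex_term; lia.
apply: ler_sum2_sym => x y xA yA; rewrite (codegC y x).
have := cB xA yA; rewrite /E (se y x); case: (boolP (e x y)) => exy cxy.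
  apply: pair_term_bound1; rewrite ?codeg_ge0 ?deg_ge0 ?aB //.
    exact: deg_ge1 exy.
  by apply: (deg_ge1 xA); rewrite se.
rewrite subr0 in cxy *.
by apply: pair_term_bound0; rewrite ?codeg_ge0 ?deg_ge0 ?aB.
Qed.
End Bound.
End CliqueStep.

(** The coefficients of [M], [P] and [Q] are nonnegative once [3 <= r], so bounds on the counts in
    [A] pass through the induction step. *)
Lemma path_steps_mono (r N M M' P P' Q Q' : int) : 3 <= r -> 0 <= N ->
  M <= M' -> P <= P' -> Q <= Q' ->
  [/\ edge2_step r N M <= edge2_step r N M',
      path2_step r N M P <= path2_step r N M' P' &
      path3_step r N M P Q <= path3_step r N M' P' Q'].
Proof.
move=> r3 N0 MM PP QQ; rewrite /edge2_step /path2_step /path3_step; split; first by lia.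
  have : (2 * r - 3) * M <= (2 * r - 3) * M' by apply: ler_wpM2l; lia.
  by lia.
have : (r - 2) * (P + M) <= (r - 2) * (P' + M') by apply: ler_wpM2l; lia.
have : (r - 1) * (N * M) <= (r - 1) * (N * M').
  by apply: ler_wpM2l; [lia | apply: ler_wpM2l].
have : (r - 2) * (r - 3) * M <= (r - 2) * (r - 3) * M'.
  by apply: ler_wpM2l => //; apply: mulr_ge0; lia.
by lia.
Qed.

(** * Edge saturation *)

Section Saturation.
Variables (V : finType) (W : {set V}).

Definition clique_bounded (e : rel V) r :=
  forall Q : {set V}, Q \subset W -> clique e Q -> (#|Q| <= r)%N.

Definition addedge (e : rel V) x y : rel V :=
  fun u v => [|| e u v, (u == x) && (v == y) | (u == y) && (v == x)].

Lemma subset_of_card (T : finType) (B : {set T}) k : (k <= #|B|)%N ->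
  exists2 C : {set T}, C \subset B & #|C| = k.
Proof.
move=> kB; have : (0 < #|[set C : {set T} | (C \subset B) && (#|C| == k)]|)%N.
  by rewrite cards_draws bin_gt0.
by case/card_gt0P => C; rewrite inE => /andP[CB /eqP]; exists C.
Qed.

(** Induction on the number of non-adjacent pairs. As long as no clique has the target size, every
    clique is smaller than it; adding an edge enlarges cliques by at most one vertex, so the bound
    [r] survives. The minimum covers the case where [W] has fewer than [r] vertices. *)
Lemma clique_saturation (e : rel V) r : symmetric e -> irreflexive e ->
  clique_bounded e r ->
  exists e', [/\ symmetric e', irreflexive e', subrel e e', clique_bounded e' r &
    exists K : {set V}, [/\ K \subset W, clique e' K & #|K| = minn r #|W|] ].
Proof.
have [m] := ubnP #|[set p : V * V | ~~ e p.1 p.2]|.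
elim: m e => // m IH e mB se ie be.
have [K cond|noK] := pickP (fun K : {set V} => [&& K \subset W,
    [forall x in K, forall y in K, (x != y) ==> e x y] & #|K| == minn r #|W|]).
  exists e; split=> //; exists K; case/and3P: cond => KW /forall_inP cK /eqP-> ; split=> //.
  by move=> x y xK yK xy; have /forall_inP/(_ _ yK)/implyP -> := cK _ xK.
have noclq (K : {set V}) : K \subset W -> clique e K -> #|K| = minn r #|W| -> False.
  move=> KW cK Kr; have := noK K; rewrite KW Kr eqxx andbT /= => /forall_inPn[].
  move=> x xK /forall_inPn[y yK]; rewrite negb_imply => /andP[xy].
  by rewrite cK.
have [x [y [xW yW xy nexy]]] : exists x y, [/\ x \in W, y \in W, x != y & ~~ e x y].
  have [K KW Kr] := subset_of_card (geq_minr r #|W|).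
  have : ~~ [forall x in K, forall y in K, (x != y) ==> e x y].
    by apply/negP => cK; have := noK K; rewrite KW Kr eqxx cK.
  case/forall_inPn => x xK /forall_inPn[y yK]; rewrite negb_imply => /andP[xy exy].
  by exists x, y; split=> //; apply: (subsetP KW).
have smallclq (Q : {set V}) : Q \subset W -> clique e Q -> (#|Q| < minn r #|W|)%N.
  move=> QW cQ; rewrite ltnNge; apply/negP => /subset_of_card[K KQ Kr].
  apply: (noclq K) => //; first exact: subset_trans QW.
  by move=> u v uK vK; apply: cQ; apply: (subsetP KQ).
have sub : subrel e (addedge e x y) by move=> u v; rewrite /addedge => ->.
case: (IH (addedge e x y)).
- rewrite -ltnS; apply: leq_trans mB; rewrite ltnS; apply: proper_card.
  apply/properP; split.
    by apply/subsetP => -[u v]; rewrite !inE; apply: contra; apply: sub.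
  by exists (x, y); rewrite !inE /= /addedge ?eqxx ?orbT.
- by move=> u v; rewrite /addedge se; case: (e v u) => //=;
  rewrite orbC [X in X || _]andbC [X in _ || X]andbC.
- move=> u; rewrite /addedge ie /=; apply/negP.
  by case/orP => /andP[/eqP-> /eqP E]; rewrite E eqxx in xy.
(* Without [x], a clique of the enlarged graph is a clique of [e], hence has fewer than [r]
   vertices. *)
- move=> Q QW cQ.
  have : (#|Q :\ x| < minn r #|W|)%N.
    apply: smallclq; first by apply: subset_trans QW; apply: subD1set.
    move=> u v; rewrite !inE => /andP[ux uQ] /andP[vx vQ] uv.
    by have := cQ _ _ uQ vQ uv; rewrite /addedge (negPf ux) (negPf vx) /= andbF orbF.
  by rewrite leq_min => /andP[Qr _]; rewrite (cardsD1 x Q);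
  case: (x \in Q); rewrite ?add1n ?add0n // ltnW.
move=> e' [se' ie' sub' be' exK]; exists e'; split=> // u v euv.
by apply: sub'; apply: sub.
Qed.
End Saturation.

(** * Degrees and codegrees into an [r]-clique when no clique is larger *)

Section CliqueFree.
Variables (V : finType) (e : rel V) (A K : {set V}) (r : nat).
Hypotheses (se : symmetric e) (ie : irreflexive e) (cK : clique e K).
Hypotheses (dAK : [disjoint A & K]) (be : clique_bounded (A :|: K) e r) (Kr : #|K| = r).

Lemma clique_setU1 (Q : {set V}) x :
  clique e Q -> {in Q, forall y, e x y} -> clique e (x |: Q).
Proof.
move=> cQ ex u v; rewrite !in_setU1 => /orP[/eqP->|uQ] /orP[/eqP->|vQ] uv.
- by rewrite eqxx in uv.
- exact: ex.
- by rewrite se ex.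
- exact: cQ.
Qed.

(** A vertex adjacent to all of [K] would extend it to a clique with [r + 1] vertices. *)
Lemma deg_le_clique_free : {in A, forall x, deg e K x <= r%:R - 1}.
Proof.
move=> x xA; have xK : x \notin K by rewrite (disjointFr dAK).
have [/forall_inP exK|/forall_inPn[k kK nek]] := boolP [forall y in K, e x y].
  have := be (Q := x |: K) _ (clique_setU1 cK exK).
  by rewrite cardsU1 xK Kr add1n ltnn => H; case: (notF (H _)); rewrite setSU // sub1set.
rewrite /deg (bigD1 k) //= (negPf nek) add0r -Kr (cardsD1 k) kK natrD addrC addKr.
rewrite -sum1_card natr_sum [leRHS](eq_bigl (fun i => (i \in K) && (i != k))).
  by apply: ler_sum => y _; rewrite ler_nat leq_b1.
by move=> y; rewrite !inE andbC.
Qed.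

(** Two adjacent vertices together with their common neighbours in [K] form a clique, so there are
    at most [r - 2] such neighbours. The non-adjacent case follows from the degree bound. *)
Lemma codeg_le_clique_free :
  {in A &, forall x y, codeg e K x y <= r%:R - 1 - (e x y)%:R}.
Proof.
move=> x y xA yA; have [exy|_] := boolP (e x y); last first.
  by rewrite subr0; apply: le_trans (deg_le_clique_free xA); apply: codeg_le_deg.
pose S := [set k in K | e x k && e y k].
have -> : codeg e K x y = #|S|%:R.
  rewrite -sum1_card natr_sum /codeg [LHS]big_mkcond [RHS]big_mkcond; apply: eq_bigr => k _.
  by rewrite inE; case: (k \in K); case: (e x k); case: (e y k).
have xK : x \notin K by rewrite (disjointFr dAK).
have yK : y \notin K by rewrite (disjointFr dAK).
have xy : x != y by apply: contraTneq exy => ->; rewrite ie.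
have SK : S \subset K by apply/subsetP => k; rewrite inE => /andP[].
have cS : clique e (x |: (y |: S)).
  apply: clique_setU1 => [|k].
    apply: clique_setU1 => [u v uS vS|k]; first by apply: cK; apply: (subsetP SK).
    by rewrite inE => /and3P[].
  by rewrite in_setU1 => /orP[/eqP->//|]; rewrite inE => /and3P[].
have : (#|x |: (y |: S)| <= r)%N.
  apply: be cS; rewrite !subUset !sub1set !inE xA yA /=.
  by apply: subset_trans SK _; apply: subsetUr.
rewrite !cardsU1 !inE (negPf xy) (negPf xK) (negPf yK) /=.
by lia.
Qed.
End CliqueFree.

(** * The Turan graph *)

Section TuranRel.
Variables (r n : nat).
Hypothesis r0 : (0 < r)%N.

Definition turan_rel : rel 'I_n := [rel x y : 'I_n | x != y %[mod r]].

(** The first [k] vertices span the Turan graph on [k] vertices, so the induction can stay inside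
    one vertex type. A block of [r] consecutive vertices meets every residue class once and serves
    as the split-off clique. *)
Definition initial (k : nat) : {set 'I_n} := [set x : 'I_n | (x < k)%N].
Definition block (k : nat) : {set 'I_n} := [set x : 'I_n | (k <= x < k + r)%N].

Lemma turan_rel_sym : symmetric turan_rel.
Proof. by move=> x y; rewrite /turan_rel /= eq_sym. Qed.

Lemma turan_rel_irr : irreflexive turan_rel.
Proof. by move=> x; rewrite /turan_rel /= eqxx. Qed.

Lemma card_initial k : (k <= n)%N -> #|initial k| = k.
Proof.
move=> kn; have winj : injective (widen_ord kn).
  by move=> i j /(congr1 val) ij; apply: val_inj.
rewrite -[RHS]card_ord -[RHS](card_imset _ winj).
apply: eq_card => x; rewrite inE; apply/idP/imsetP => [xk|[y _ ->]]; last exact: (valP y).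
by exists (Ordinal xk) => //; apply: val_inj.
Qed.

Lemma initialD k : initial (k + r) = initial k :|: block k.
Proof. by apply/setP => x; rewrite !inE; lia. Qed.

Lemma disjoint_initial_block k : [disjoint initial k & block k].
Proof. by apply/pred0P => x; rewrite /= !inE; lia. Qed.

Lemma card_block k : (k + r <= n)%N -> #|block k| = r.
Proof.
move=> kn; have := card_initial kn.
rewrite initialD cardsU disjoint_setI0 ?disjoint_initial_block // cards0 subn0.
by rewrite card_initial; lia.
Qed.

Lemma eq_mod_block (k x y : nat) : (k <= x < k + r)%N -> (k <= y < k + r)%N ->
  x = y %[mod r] -> x = y.
Proof.
move=> xB yB; have lexy (u v : nat) : (k <= u < k + r)%N -> (k <= v < k + r)%N ->
    u = v %[mod r] -> (u <= v)%N.
  move=> uB vB /eqP uv; rewrite leqNgt; apply/negP => vu.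
  move: uv; rewrite eqn_mod_dvd 1?ltnW // => /dvdn_leq; lia.
by move=> xy; apply/eqP; rewrite eqn_leq; apply/andP; split; apply: lexy.
Qed.

Lemma clique_block k : clique turan_rel (block k).
Proof.
move=> x y; rewrite !inE => xB yB; apply: contraNT; rewrite negbK => /eqP xy.
by apply/eqP/val_inj/(eq_mod_block xB yB).
Qed.

Lemma clique_initial k : (k <= r)%N -> clique turan_rel (initial k).
Proof.
move=> kr x y; rewrite !inE => xB yB; apply: contraNT; rewrite negbK => /eqP.
by rewrite !modn_small; [move=> /val_inj -> | lia | lia].
Qed.

Lemma block_transversal k (z : nat) : (k + r <= n)%N ->
  exists2 l, l \in block k & forall x, x \in block k -> (x == z %[mod r]) = (x == l).
Proof.
(* Adding [k * r.-1] replaces subtracting [k] modulo [r], as [k + k * r.-1] is a multiple of [r]. *)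
move=> kn; pose m := (k + (z + k * r.-1) %% r)%N.
have mr : ((z + k * r.-1) %% r < r)%N by rewrite ltn_mod.
have mB : (k <= m < k + r)%N by rewrite /m; lia.
have mn : (m < n)%N by lia.
have mz : m = z %[mod r].
  by rewrite /m modnDmr addnCA -mulnS prednK // addnC modnMDl.
exists (Ordinal mn); first by rewrite inE.
move=> x; rewrite inE => xB; rewrite -mz; apply/eqP/eqP => [xm|->//].
by apply: val_inj; apply: (eq_mod_block xB mB).
Qed.

Lemma sum_block k z (F : 'I_n -> int) : (k + r <= n)%N ->
  exists2 l : 'I_n, l = z %[mod r] & \sum_(x in block k) F x * (x == z %[mod r])%:R = F l.
Proof.
move=> kn; have [l lB lP] := block_transversal z kn.
exists l; first by apply/eqP; rewrite lP.
by rewrite -(sum_pred1 F lB); apply: eq_bigr => x /lP ->.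
Qed.

Lemma turan_relE x y : (turan_rel x y)%:R = 1 - (y == x %[mod r])%:R :> int.
Proof. by rewrite /turan_rel /= eq_sym; case: (_ == _). Qed.

Lemma turan_deg_block k x : (k + r <= n)%N -> deg turan_rel (block k) x = r%:R - 1.
Proof.
move=> kn; rewrite /deg; under eq_bigr do rewrite turan_relE.
have [l _ lS] := sum_block x (fun=> 1) kn.
rewrite sumrB sumr_const card_block //; congr (_ - _).
by rewrite -[RHS]lS; apply: eq_bigr => y _; rewrite mul1r.
Qed.

(** In the block, [x] misses only the vertex [l] of its own class. This removes one neighbour of [y]
    exactly when [l], equivalently [x], is adjacent to [y]. *)
Lemma turan_codeg_block k x y : (k + r <= n)%N ->
  codeg turan_rel (block k) x y = r%:R - 1 - (turan_rel x y)%:R.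
Proof.
move=> kn; have [l lx lS] := sum_block x (fun z => (turan_rel y z)%:R) kn.
have -> : codeg turan_rel (block k) x y = deg turan_rel (block k) y -
    \sum_(z in block k) (turan_rel y z)%:R * (z == x %[mod r])%:R.
  rewrite -sumrB; apply: eq_bigr => z _; rewrite (turan_relE x); ring.
by rewrite turan_deg_block // lS /turan_rel /= lx eq_sym.
Qed.
End TuranRel.

(** * The extremal inequality for relations *)

Section Extremal.
Variables (r n : nat).
Hypothesis r3 : (3 <= r)%N.

(* Both sides are the case [A = set0] of the splitting identities. *)
Lemma path_count_clique (V V' : finType) (e : rel V) (e' : rel V') K K' :
  symmetric e -> irreflexive e -> symmetric e' -> irreflexive e' ->
  clique e K -> clique e' K' -> #|K| = #|K'| ->
  [/\ edge2 e K = edge2 e' K', path2 e K = path2 e' K' & path3 e K = path3 e' K'].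
Proof.
move=> se ie se' ie' cK cK' KK'.
have d0 (T : finType) (B : {set T}) : [disjoint set0 & B].
  by rewrite -setI_eq0 set0I.
rewrite -(set0U K) -(set0U K').
rewrite !edge2_split // !path2_split // !path3_split //.
rewrite KK' /edge2 /path2 /path3 !big_set0.
by [].
Qed.

(** Induction on [k] in steps of [r]. The three counts are compared together because the step for
    3-edge paths involves the edges and the 2-edge paths of the remaining set. *)
Lemma turan_extremal (V : finType) k (e : rel V) (W : {set V}) :
  symmetric e -> irreflexive e -> clique_bounded W e r -> #|W| = k -> (k <= n)%N ->
  [/\ edge2 e W <= edge2 (turan_rel r (n := n)) (initial n k),
      path2 e W <= path2 (turan_rel r (n := n)) (initial n k) &
      path3 e W <= path3 (turan_rel r (n := n)) (initial n k)].
Proof.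
elim/ltn_ind: k e W => k IH e W se ie be Wk kn.
have [e' [se' ie' sub be' [K [KW cK Kr]]]] := clique_saturation se ie be.
suff [M P Q] : [/\ edge2 e' W <= edge2 (turan_rel r (n := n)) (initial n k),
      path2 e' W <= path2 (turan_rel r (n := n)) (initial n k) &
      path3 e' W <= path3 (turan_rel r (n := n)) (initial n k)].
  split; [apply: le_trans M | apply: le_trans P | apply: le_trans Q].
  - exact: edge2_mono.
  - exact: path2_mono.
  - exact: path3_mono.
have st := @turan_rel_sym r n; have it := @turan_rel_irr r n.
have r0 : (0 < r)%N by lia.
(* Below [r] vertices the saturated graph and the Turan graph are both complete. *)
have [kr|rk] := ltnP k r.
  have WK : W = K.
    by apply/esym/eqP; rewrite eqEcard KW Kr Wk /=; lia.
  have cI := @clique_initial r n r0 k (ltnW kr).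
  have WI : #|W| = #|initial n k| by rewrite Wk card_initial.
  rewrite -WK in cK.
  by have [-> -> ->] := path_count_clique se' ie' st it cK cI WI.
have Kr' : #|K| = r by rewrite Kr Wk; lia.
have kE : k = (k - r + r)%N by lia.
have kn' : (k - r + r <= n)%N by lia.
pose A := W :\: K.
have WE : W = A :|: K.
  by apply/setP => x; rewrite !inE; case: (boolP (x \in K)) => [/(subsetP KW)->|];
    rewrite ?andbF ?orbT ?orbF.
have dAK : [disjoint A & K] by rewrite -setI_eq0 setIDAC -setIDA setDv setI0.
have Ak : #|A| = (k - r)%N by rewrite cardsD (setIidPr KW) Wk Kr'.
have bA : clique_bounded A e' r.
  by move=> S SA; apply: be'; apply: subset_trans SA _; apply: subsetDl.
have [||M P Q] := IH (k - r)%N _ e' A se' ie' bA Ak; [lia | lia |].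
have bAK : clique_bounded (A :|: K) e' r by rewrite -WE.
have r3' : 3 <= #|K|%:R :> int by rewrite Kr'; lia.
have aB := deg_le_clique_free se' cK dAK bAK Kr'.
have cB := codeg_le_clique_free se' ie' cK dAK bAK Kr'.
(* On the Turan side the last [r] of the [k] vertices are removed, and every degree bound is an
   equality. *)
have dB : [disjoint initial n (k - r) & block r n (k - r)].
  exact: disjoint_initial_block.
have cKt : clique (turan_rel r (n := n)) (block r n (k - r)) by apply: clique_block.
have Br : #|block r n (k - r)| = r by rewrite card_block.
have aE : {in initial n (k - r), forall x,
    deg (turan_rel r (n := n)) (block r n (k - r)) x = #|block r n (k - r)|%:R - 1}.
  by move=> x _; rewrite turan_deg_block // Br.
have cE : {in initial n (k - r) &, forall x y,
    codeg (turan_rel r (n := n)) (block r n (k - r)) x y =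
    #|block r n (k - r)|%:R - 1 - (turan_rel r x y)%:R}.
  by move=> x y _ _; rewrite turan_codeg_block // Br.
rewrite WE kE initialD //.
rewrite (edge2_tight st it dB cKt aE) (path2_tight st it dB cKt aE cE).
rewrite (path3_tight st it dB cKt aE cE) Br card_initial; last by lia.
have N0 : 0 <= #|A|%:R :> int by [].
have [M' P' Q'] := path_steps_mono r3' N0 M P Q.
rewrite -Kr' in aB cB.
have := edge2_bound se' ie' dAK cK r3' aB.
have := path2_bound se' ie' dAK cK r3' aB cB.
have := path3_bound se' ie' dAK cK r3' aB cB.
move=> /le_trans/(_ Q') Q'' /le_trans/(_ P') P'' /le_trans/(_ M') M''.
by rewrite Kr' Ak in M'' P'' Q''.
Qed.
End Extremal.

(** * Copies of the path and ordered tuples *)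

Section GraphRel.
Variables (V : finType) (G : sgraph V).
Implicit Types (x y z w : V) (t : V * V * (V * V)).

Definition adj : rel V := [rel x y | [set x; y] \in edges G].

Lemma adj_sym : symmetric adj.
Proof. by move=> x y; rewrite /adj /= setUC. Qed.

Lemma adj_irr : irreflexive adj.
Proof.
move=> x; apply/negP; rewrite /adj /= => /(forall_inP (edges_card2 G)).
by rewrite cards2 eqxx.
Qed.

Lemma adj_neq x y : adj x y -> x != y.
Proof. by apply: contraTneq => ->; rewrite adj_irr. Qed.

Lemma eq_set2 x y z w : [set x; y] = [set z; w] ->
  (x = z /\ y = w) \/ (x = w /\ y = z).
Proof.
move=> E.
have : (x \in [set z; w]) && (y \in [set z; w]) by rewrite -E set21 set22.
have : (z \in [set x; y]) && (w \in [set x; y]) by rewrite E set21 set22.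
rewrite !inE => /andP[/orP[]/eqP? /orP[]/eqP?] /andP[/orP[]/eqP? /orP[]/eqP?].
all: by subst; auto.
Qed.

(** The nesting of the pairs is the one produced by merging the four sums of [path3] two by two. *)
Definition path_tuples : {set V * V * (V * V)} :=
  [set t | [&& adj t.1.1 t.1.2, adj t.1.2 t.2.1, adj t.2.1 t.2.2,
            t.1.1 != t.2.1, t.1.1 != t.2.2 & t.1.2 != t.2.2]].

Definition tuple_copy t : {set V} * {set {set V}} :=
  ([set t.1.1; t.1.2; t.2.1; t.2.2],
   [set [set t.1.1; t.1.2]; [set t.1.2; t.2.1]; [set t.2.1; t.2.2]]).

Definition tuple_rev t : V * V * (V * V) := (t.2.2, t.2.1, (t.1.2, t.1.1)).

Lemma tuple_copy_rev t : tuple_copy (tuple_rev t) = tuple_copy t.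
Proof.
case: t => -[x y] [z w]; rewrite /tuple_copy /tuple_rev /=; congr (_, _).
  by apply/setP => u; rewrite !inE; do 4!case: (u == _).
rewrite (setUC [set w] [set z]) (setUC [set z] [set y]) (setUC [set y] [set x]).
by apply/setP => u; rewrite !inE; do 3!case: (u == _).
Qed.

Local Ltac neq_absurd :=
  match goal with H : is_true (?u != ?u) |- _ => by rewrite eqxx in H end.

(** The edge set alone suffices: each edge of [t'] is one of the three edges of [t] in one of two
    orientations, and distinctness of the vertices excludes all combinations except the two readings
    of the path. *)
Lemma tuple_copy_fiber t t' : t \in path_tuples -> t' \in path_tuples ->
  tuple_copy t' = tuple_copy t -> t' = t \/ t' = tuple_rev t.
Proof.
case: t t' => -[x y] [z w] [[x' y'] [z' w']]; rewrite !inE /tuple_copy /tuple_rev /=.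
case/and5P=> /adj_neq xy /adj_neq yz /adj_neq zw xz /andP[xw yw].
case/and5P=> /adj_neq xy' /adj_neq yz' /adj_neq zw' xz' /andP[xw' yw'].
case=> _ E.
have e1 : [set x'; y'] \in [set [set x; y]; [set y; z]; [set z; w]].
  by rewrite -E !inE eqxx.
have e2 : [set y'; z'] \in [set [set x; y]; [set y; z]; [set z; w]].
  by rewrite -E !inE eqxx orbT.
have e3 : [set z'; w'] \in [set [set x; y]; [set y; z]; [set z; w]].
  by rewrite -E !inE eqxx !orbT.
have edgeP u v : [set u; v] \in [set [set x; y]; [set y; z]; [set z; w]] ->
  [\/ u = x /\ v = y, u = y /\ v = x | [\/ u = y /\ v = z, u = z /\ v = y |
      u = z /\ v = w \/ u = w /\ v = z]].
  rewrite !inE => /orP[/orP[]|] /eqP/eq_set2[] [-> ->].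
  - by constructor 1.
  - by constructor 2.
  - by constructor 3; constructor 1.
  - by constructor 3; constructor 2.
  - by constructor 3; constructor 3; left.
  - by constructor 3; constructor 3; right.
case: (edgeP _ _ e1) => [[? ?]|[? ?]|[[? ?]|[? ?]|[[? ?]|[? ?]]]]; subst;
case: (edgeP _ _ e2) => [[? ?]|[? ?]|[[? ?]|[? ?]|[[? ?]|[? ?]]]]; subst;
  try neq_absurd;
case: (edgeP _ _ e3) => [[? ?]|[? ?]|[[? ?]|[? ?]|[[? ?]|[? ?]]]]; subst;
  try (by left); try (by right);
  neq_absurd.
Qed.

Lemma edges_pathg3 : edges (pathg 3) =
  [set [set @Ordinal 4 0 isT; @Ordinal 4 1 isT];
       [set @Ordinal 4 1 isT; @Ordinal 4 2 isT];
       [set @Ordinal 4 2 isT; @Ordinal 4 3 isT]].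
Proof.
apply/setP => a; rewrite !inE; apply/existsP/idP => [[i /existsP[j /and3P[_ /= ij /eqP->]]]|].
  have val4 k (kl : (k < 4)%N) (l : 'I_4) : l = k :> nat -> l = Ordinal kl.
    by move=> lk; apply: val_inj.
  have := ltn_ord j; rewrite (eqP ij); case: i ij => -[|[|[|//]]] il /eqP/= ij _.
  - by rewrite (val4 1%N isT j) // (val4 0%N isT (Ordinal il)) // eqxx.
  - by rewrite (val4 2%N isT j) // (val4 1%N isT (Ordinal il)) // eqxx orbT.
  - by rewrite (val4 3%N isT j) // (val4 2%N isT (Ordinal il)) // eqxx orbT.
case/orP => [/orP[]|] /eqP->.
- by exists (@Ordinal 4 0 isT); apply/existsP; exists (@Ordinal 4 1 isT); rewrite !eqxx.
- by exists (@Ordinal 4 1 isT); apply/existsP; exists (@Ordinal 4 2 isT); rewrite !eqxx.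
- by exists (@Ordinal 4 2 isT); apply/existsP; exists (@Ordinal 4 3 isT); rewrite !eqxx.
Qed.

Lemma imset_pathg3 (f : 'I_4 -> V) :
  (f @: setT, [set f @: (a : {set 'I_4}) | a in edges (pathg 3)]) =
  tuple_copy (f (@Ordinal 4 0 isT), f (@Ordinal 4 1 isT),
             (f (@Ordinal 4 2 isT), f (@Ordinal 4 3 isT))).
Proof.
rewrite edges_pathg3 !imsetU !imset_set1 !imsetU !imset_set1; congr (_, _).
have -> : [set: 'I_4] = [set @Ordinal 4 0 isT; @Ordinal 4 1 isT;
                             @Ordinal 4 2 isT; @Ordinal 4 3 isT].
  by apply/setP => -[[|[|[|[|//]]]] il]; rewrite !inE.
by rewrite !imsetU !imset_set1.
Qed.

Lemma copies_path3 : copies (pathg 3) G = [set tuple_copy t | t in path_tuples].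
Proof.
apply/setP => S; rewrite inE; apply/andP/imsetP => [[/andP[sub _]]|[t tP ->]].
  case/existsP => f /and3P[/injectiveP finj /eqP f1 /eqP f2].
  have SE : S = tuple_copy (f (@Ordinal 4 0 isT), f (@Ordinal 4 1 isT),
             (f (@Ordinal 4 2 isT), f (@Ordinal 4 3 isT))).
    by rewrite -imset_pathg3 f1 f2; case: S {sub f1 f2}.
  eexists; last exact: SE.
  move: sub; rewrite SE /tuple_copy /= !subUset !sub1set => /andP[/andP[e1 e2] e3].
  by rewrite inE /adj /= e1 e2 e3 !(inj_eq finj).
move: (tP); rewrite inE => /and5P[e1 e2 e3 xz /andP[xw yw]].
have xy := adj_neq e1; have yz := adj_neq e2; have zw := adj_neq e3.
case: t tP e1 e2 e3 xz xw yw xy yz zw => -[x y] [z w] /= tP e1 e2 e3 xz xw yw xy yz zw.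
split.
  rewrite /is_subgraph /= !subUset !sub1set [_ \in _]e1 [_ \in _]e2 [_ \in _]e3 /=.
  apply/forall_inP => a; rewrite !inE => /orP[/orP[]|] /eqP->;
  by rewrite !subUset !sub1set !inE !eqxx ?orbT.
apply/existsP; exists [ffun i : 'I_4 => nth x [:: x; y; z; w] i].
have := imset_pathg3 [ffun i : 'I_4 => nth x [:: x; y; z; w] i]; rewrite !ffunE /=.
case=> -> ->; rewrite !eqxx !andbT.
apply/injectiveP => i j; rewrite !ffunE => /eqP.
rewrite nth_uniq ?ltn_ord // => [/eqP/val_inj//|].
by rewrite /= !inE !negb_or xy xz xw yz yw zw.
Qed.

(** Every fibre of [tuple_copy] consists of a tuple and its reversal, which differ because the ends
    of the path do. *)
Lemma nu_path3 : #|path_tuples| = (2 * nu (pathg 3) G)%N.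
Proof.
rewrite /nu copies_path3 -sum1_card (partition_big_imset tuple_copy) /=.
rewrite (eq_bigr (fun=> 2%N)); first by rewrite sum_nat_const mulnC.
move=> S /imsetP[t tP ->]; rewrite sum1_card.
have rP : tuple_rev t \in path_tuples.
  move: tP; rewrite !inE /= => /and5P[e1 e2 e3 xz /andP[xw yw]].
  by rewrite adj_sym e3 adj_sym e2 adj_sym e1 eq_sym yw eq_sym xw eq_sym xz.
rewrite (eq_card (B := mem [set t; tuple_rev t])); last first.
  move=> t'; rewrite [LHS]unfold_in [RHS]in_set2 /=.
  apply/andP/orP => [[t'P /eqP E]|[]/eqP->]; last 2 first.
  - by rewrite tP eqxx.
  - by rewrite rP tuple_copy_rev eqxx.
  by case: (tuple_copy_fiber tP t'P E) => ->; [left | right].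
rewrite cards2; have -> // : t != tuple_rev t.
move: tP; rewrite inE => /and5P[_ _ _ _ /andP[xw _]].
by apply: contraNneq xw => {1}->.
Qed.

Lemma path3_setT : path3 adj setT = (2 * nu (pathg 3) G)%:R.
Proof.
rewrite -nu_path3 -sum1_card natr_sum [RHS]big_mkcond /path3 pair_big /=.
under eq_bigr do rewrite pair_big.
rewrite pair_big [LHS]big_mkcond; apply: eq_bigr => t _ /=.
by rewrite !inE; case: ifP.
Qed.

(** Enumerating [r + 1] vertices of a larger clique would give a copy of the complete graph. *)
Lemma free_clique_bounded r : subgraph_free (completeg r.+1) G ->
  clique_bounded setT adj r.
Proof.
move=> /eqP free Q _ cQ; rewrite leqNgt; apply/negP => /subset_of_card[C CQ Cr].
pose f : {ffun 'I_r.+1 -> V} := [ffun i => enum_val (cast_ord (esym Cr) i)].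
have finj : injective f.
  by move=> i j; rewrite !ffunE => /enum_val_inj/cast_ord_inj.
have : (f @: setT, [set f @: (a : {set 'I_r.+1}) | a in edges (completeg r.+1)])
    \in copies (completeg r.+1) G.
  rewrite inE; apply/andP; split; last first.
    by apply/existsP; exists f; rewrite !eqxx !andbT; apply/injectiveP.
  apply/andP; split; last first.
    by apply/forall_inP => _ /imsetP[a _ ->] /=; apply: imsetS; apply: subsetT.
  apply/subsetP => _ /imsetP[a + ->] /=.
  rewrite inE => /existsP[i /existsP[j /and3P[ij _ /eqP->]]].
  rewrite imsetU !imset_set1; apply: cQ; rewrite ?(inj_eq finj) //.
    by apply: (subsetP CQ); rewrite ffunE enum_valP.
  by apply: (subsetP CQ); rewrite ffunE enum_valP.
by rewrite free inE.
Qed.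

End GraphRel.

(** * The extremal inequality for numbers of copies *)

Lemma adj_turang r n : adj (turang r n) =2 turan_rel r (n := n).
Proof.
move=> x y; rewrite /adj /= sgraph_of_relE /= [in X in _ || X]eq_sym orbb.
by case: eqVneq => [->|] //=; rewrite turan_rel_irr.
Qed.

(** Pigeonhole: [r + 1] pairwise adjacent vertices would have distinct residues modulo [r]. *)
Lemma turang_free r n : (0 < r)%N -> subgraph_free (completeg r.+1) (turang r n).
Proof.
move=> r0; apply/eqP/setP => S; rewrite [RHS]inE; apply/negP; rewrite inE.
case/andP => /andP[sub _] /existsP[f /and3P[/injectiveP finj _ /eqP f2]].
have fr (i : 'I_r.+1) : (f i %% r < r)%N by rewrite ltn_mod.
have : injective (fun i => Ordinal (fr i)).
  move=> i j /(congr1 val)/= fij; apply/eqP; apply/negPn/negP => ij.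
  have : adj (turang r n) (f i) (f j).
    apply: (subsetP sub); rewrite -f2; apply/imsetP; exists [set i; j].
      by rewrite sgraph_of_relE ij.
    by rewrite imsetU !imset_set1.
  by rewrite adj_turang /turan_rel /= fij eqxx.
by move/leq_card; rewrite !card_ord ltnn.
Qed.

Lemma nu_turang r n :
  path3 (turan_rel r (n := n)) setT = (2 * nu (pathg 3) (turang r n))%:R.
Proof.
(* The two relations agree pointwise, so monotonicity in both directions gives equality of the
   counts. *)
rewrite -path3_setT; apply: le_anti; apply/andP.
by split; apply: path3_mono => x y; rewrite adj_turang.
Qed.

Lemma nu_path3_le_turang r n (G : sgraph 'I_n) : (3 <= r)%N ->
  subgraph_free (completeg r.+1) G -> (nu (pathg 3) G <= nu (pathg 3) (turang r n))%N.
Proof.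
move=> r3 /free_clique_bounded be.
have setTE : initial n n = setT by apply/setP => x; rewrite !inE ltn_ord.
have cT : #|[set: 'I_n]| = n by rewrite cardsT card_ord.
have [_ _] := turan_extremal r3 (adj_sym G) (adj_irr G) be cT (leqnn n).
by rewrite setTE nu_turang path3_setT ler_nat leq_pmul2l.
Qed.

Lemma turan_good_path3 r : (3 <= r)%N -> turan_good r (pathg 3).
Proof.
move=> r3; exists 0%N => n _; apply/eqP; rewrite eqn_leq; apply/andP; split.
  by apply/bigmax_leqP => G; apply: nu_path3_le_turang.
by apply: leq_bigmax_cond; apply: turang_free; lia.
Qed.

(** * The limit density *)

Lemma turan_deg_bounds r n (x : 'I_n) : (0 < r)%N ->
  n%:R - (n %/ r)%:R - 1 <= deg (turan_rel r (n := n)) setT x <= n%:R - (n %/ r)%:R.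
Proof.
move=> r0; rewrite /deg; under eq_bigr do rewrite turan_relE.
rewrite sumrB sumr_const cardsT card_ord -/(n%:R).
have -> : \sum_(y in [set: 'I_n]) (y == x %[mod r])%:R =
    #|[set y : 'I_n | (y == x %% r %[mod r])%N]|%:R :> int.
  rewrite -sum1_card natr_sum [RHS]big_mkcond; apply: eq_big => y; first by rewrite inE.
  by move=> _; rewrite inE modn_mod; case: eqP.
rewrite card_turan_part ?ltn_mod // natrD.
by case: (_ < _)%N; lia.
Qed.

(** In [path3E] each factor [deg - 1] lies between [h - 2] and [h], and the triangle term [T] lies
    between 0 and the cube of the number of vertices. *)
Lemma path3_deg_bounds (V : finType) (e : rel V) (h : int) :
  symmetric e -> irreflexive e -> 2 <= h ->
  (forall x, h - 1 <= deg e setT x <= h) ->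
  #|V|%:R * ((h - 1) * ((h - 2) * (h - 2))) - #|V|%:R * (#|V|%:R * #|V|%:R)
    <= path3 e setT <= #|V|%:R * (h * (h * h)).
Proof.
move=> se ie h2 dB; rewrite path3E //.
set S := \sum_(x in _) _; set T := \sum_(x in _) _.
have cT (k : int) : \sum_(x in [set: V]) k = #|V|%:R * k.
  by rewrite sumr_const cardsT -[LHS]mulr_natl.
have T0 : 0 <= T.
  apply: sumr_ge0 => x _; apply: sumr_ge0 => y _; apply: mulr_ge0; first exact: ler0n.
  by apply: sumr_ge0 => z _; rewrite mulr_ge0 ?ler0n.
have TB : T <= #|V|%:R * (#|V|%:R * #|V|%:R).
  rewrite -!cT; apply: ler_sum2 => x y _ _.
  have -> : #|V|%:R = \sum_(z in [set: V]) 1 :> int by rewrite cT mulr1.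
  rewrite mulr_sumr; apply: ler_sum => z _.
  by case: (e x y); case: (e x z); case: (e y z).
have SL : \sum_(x in [set: V]) deg e setT x * ((h - 2) * (h - 2)) <= S.
  apply: ler_sum => x _; rewrite mulr_suml; apply: ler_sum => y _.
  apply: ler_wpM2l; first exact: ler0n.
  by have := dB x; have := dB y; move=> ? ?; apply: ler_pM; lia.
have SU : S <= \sum_(x in [set: V]) deg e setT x * (h * h).
  apply: ler_sum => x _; rewrite mulr_suml; apply: ler_sum => y _.
  apply: ler_wpM2l; first exact: ler0n.
  by have := dB x; have := dB y; move=> ? ?; apply: ler_pM; lia.
have SL' : #|V|%:R * ((h - 1) * ((h - 2) * (h - 2))) <=
    \sum_(x in [set: V]) deg e setT x * ((h - 2) * (h - 2)).
  rewrite -cT; apply: ler_sum => x _; apply: ler_wpM2r; first by apply: mulr_ge0; lia.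
  by case/andP: (dB x).
have SU' : \sum_(x in [set: V]) deg e setT x * (h * h) <= #|V|%:R * (h * (h * h)).
  rewrite -cT; apply: ler_sum => x _; apply: ler_wpM2r; first by apply: mulr_ge0; lia.
  by case/andP: (dB x).
by lia.
Qed.

Section Limit.
Variables (R : realType) (r : nat).
Hypothesis r3 : (3 <= r)%N.
Let rho : R := (r%:R - 1) / r%:R.

Lemma max_density_turang n :
  max_density R r (pathg 3) n = density R (pathg 3) (turang r n).
Proof.
apply: le_anti; apply/andP; split; last first.
  by apply: le_bigmax_cond; apply: turang_free; lia.
apply: bigmax_le => [|G free]; first by rewrite divr_ge0.
by rewrite ler_wpM2r ?invr_ge0 // ler_nat nu_path3_le_turang.
Qed.

Lemma path3_turan_asymp n : (4 <= n)%N ->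
  `|(nu (pathg 3) (turang r n))%:R * 2 - rho ^+ 3 * n%:R ^+ 4| <= 10 * n%:R ^+ 3 :> R.
Proof.
move=> n4; have r0 : (0 < r)%N by lia.
have qn : (n %/ r * 3 <= n)%N.
  by apply: leq_trans (leq_trunc_div n r); rewrite leq_mul2l r3 orbT.
have h2 : 2 <= n%:R - (n %/ r)%:R :> int by lia.
have dB (x : 'I_n) : n%:R - (n %/ r)%:R - 1 <= deg (turan_rel r (n := n)) setT x <=
    n%:R - (n %/ r)%:R := turan_deg_bounds x r0.
have := path3_deg_bounds (@turan_rel_sym r n) (@turan_rel_irr r n) h2 dB.
rewrite nu_turang card_ord => /andP[].
rewrite -!(ler_int R) !(rmorphB, rmorphM, rmorph1, rmorph_nat) /=.
set X := (nu _ _)%:R * 2; rewrite natrM (mulrC 2) -/X.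
set q : R := (n %/ r)%:R; set N : R := n%:R.
have r0R : 0 < r%:R :> R by rewrite ltr0n.
have hE : N - N / r%:R = rho * N by rewrite /rho; field; rewrite lt0r_neq0.
have qU : q <= N / r%:R by rewrite ler_pdivlMr // -natrM ler_nat leq_trunc_div.
have qL : N / r%:R <= q + 1.
  rewrite ler_pdivrMr // -[1]/(1%:R) -natrD -natrM ler_nat addn1 ltnW //.
  exact: ltn_ceil.
have q0 : 0 <= q by [].
have N4 : 4 <= N by rewrite ler_nat.
have Nr0 : 0 <= N / r%:R by apply: divr_ge0.
set h := N - q; set t := rho * N in hE *.
have -> : rho ^+ 3 * N ^+ 4 = N * t ^+ 3 by rewrite /t; ring.
(* [h - t] is the fractional part of [n / r]. Replacing [h] by [t] costs at most [3 * N ^+ 3] above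
   and [9 * N ^+ 3] below; triangles add [N ^+ 3] below, whence the constant 10. *)
have th : 0 <= h - t <= 1 by rewrite /h -hE; lra.
have hN : h <= N by rewrite /h; lra.
have t0 : 0 <= t by rewrite /t mulr_ge0 // /rho divr_ge0 // subr_ge0 ler1n.
move: th => /andP[th1 th2] lo up.
have N0 : 0 <= N by [].
have cube : h ^+ 3 - t ^+ 3 <= 3 * N ^+ 2.
  have -> : h ^+ 3 - t ^+ 3 = (h - t) * (h ^+ 2 + h * t + t ^+ 2) by ring.
  have sq : h ^+ 2 + h * t + t ^+ 2 <= 3 * N ^+ 2 by nra.
  have sq0 : 0 <= h ^+ 2 + h * t + t ^+ 2 by nra.
  by nra.
have cube0 : t ^+ 3 <= h ^+ 3 by rewrite lerXn2r ?nnegrE //; lra.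
have up' : N * (h ^+ 3) <= N * (t ^+ 3 + 3 * N ^+ 2) by apply: ler_wpM2l => //; lra.
have lo' : N * (t ^+ 3 - 9 * N ^+ 2) <= N * ((h - 1) * ((h - 2) * (h - 2))).
  apply: ler_wpM2l => //.
  have -> : (h - 1) * ((h - 2) * (h - 2)) = h ^+ 3 - 5 * h ^+ 2 + 8 * h - 4 by ring.
  have : h ^+ 2 <= N ^+ 2 by nra.
  by nra.
have N3 : 0 <= N ^+ 3 by apply: exprn_ge0.
rewrite ler_norml; apply/andP; split.
  have e1 : N * (t ^+ 3 - 9 * N ^+ 2) = N * t ^+ 3 - 9 * N ^+ 3 by ring.
  have e2 : N * (N * N) = N ^+ 3 by ring.
  have e3 : N - q - 1 = h - 1 by [].
  by lra.
have e1 : N * (t ^+ 3 + 3 * N ^+ 2) = N * t ^+ 3 + 3 * N ^+ 3 by ring.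
have e2 : N * (h * (h * h)) = N * h ^+ 3 by ring.
by lra.
Qed.

Lemma bin4_natr n : (4 <= n)%N ->
  24 * 'C(n, 4)%:R = n%:R * (n%:R - 1) * (n%:R - 2) * (n%:R - 3) :> R.
Proof.
case: n => [|[|[|[|n]]]] // _.
have := congr1 (fun k => k%:R : R) (bin_ffact n.+4 4); rewrite natrM mulrC => ->.
rewrite !ffactSS ffactn0 !natrM -[n.+4]addn4 -[n.+3]addn3 -[n.+2]addn2 -[n.+1]addn1.
by rewrite !natrD; ring.
Qed.

(** The numerator error is at most [8 * N ^+ 3]: 5 from the path count and 3 from comparing [24 * C]
    with [N ^+ 4]. For [12 <= n] the binomial is at least [N ^+ 4 / 48], and 8 times 48 is 384. *)
Lemma density_turang_asymp n : (12 <= n)%N ->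
  `|12 * rho ^+ 3 - density R (pathg 3) (turang r n)| <= 384 / n%:R.
Proof.
move=> n12; have n4 : (4 <= n)%N by lia.
have := path3_turan_asymp n4; have := bin4_natr n4.
rewrite /density !card_ord.
set X : R := (nu _ _)%:R; set C : R := 'C(n, 4)%:R; set N : R := n%:R.
move=> CE XB.
have N12 : 12 <= N by rewrite ler_nat.
set k := rho ^+ 3 in XB *.
have rho01 : 0 <= rho <= 1.
  have r0R : 0 < r%:R :> R by rewrite ltr0n; lia.
  rewrite /rho ler_pdivrMr // mul1r gerBl ler01 andbT.
  by rewrite divr_ge0 // subr_ge0 ler1n; lia.
have k01 : 0 <= k <= 1 by case/andP: rho01 => ? ?; rewrite exprn_ge0 // exprn_ile1.
have N0 : 0 < N by lra.
have N3 : 0 <= N ^+ 3 by rewrite exprn_ge0 // ltW.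
have N43 : 12 * N ^+ 3 <= N ^+ 4 by rewrite [N ^+ 4]exprS ler_wpM2r.
have ZL : N ^+ 4 - 6 * N ^+ 3 <= 24 * C.
  rewrite CE; have -> : N * (N - 1) * (N - 2) * (N - 3) =
    N ^+ 4 - 6 * N ^+ 3 + (11 * N - 6) * N by ring.
  by rewrite lerDl; apply: mulr_ge0; lra.
have ZU : 24 * C <= N ^+ 4.
  rewrite CE; have -> : N * (N - 1) * (N - 2) * (N - 3) =
    N ^+ 4 - (6 * N ^+ 2 - 11 * N + 6) * N by ring.
  by rewrite gerBl; apply: mulr_ge0; nra.
have N4p : 0 < N ^+ 4 by rewrite exprn_gt0.
have C0 : 0 < C by lra.
have -> : 12 * k - X / C = (12 * k * C - X) / C by field; rewrite lt0r_neq0.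
rewrite normrM normfV (gtr0_norm C0) ler_pdivrMr // [leRHS]mulrAC ler_pdivlMr //.
have kZL : k * (N ^+ 4 - 6 * N ^+ 3) <= k * (24 * C) by apply: ler_wpM2l => //; lra.
have kZU : k * (24 * C) <= k * N ^+ 4 by apply: ler_wpM2l => //; lra.
have kN : k * N ^+ 3 <= N ^+ 3 by rewrite ler_piMl //; lra.
have num : `|12 * k * C - X| <= 8 * N ^+ 3.
  by move: XB; rewrite !ler_norml => /andP[]; lra.
apply: le_trans (ler_wpM2r (ltW N0) num) _.
by rewrite -mulrA -exprSr; lra.
Qed.

Lemma cvg_max_density :
  (max_density R r (pathg 3) n @[n --> \oo] --> 12 * rho ^+ 3)%classic.
Proof.
apply/cvgrPdist_le => eps eps0; near=> n.
rewrite max_density_turang; apply: le_trans (density_turang_asymp _) _.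
  by near: n; apply: nbhs_infty_ge.
have n0 : 0 < n%:R :> R by rewrite ltr0n; near: n; apply: nbhs_infty_ge.
rewrite ler_pdivrMr // mulrC -ler_pdivrMr //.
by near: n; apply: nbhs_infty_ger.
Unshelve. all: by end_near.
Qed.
End Limit.

Theorem theorem1p3 (R : realType) (r : nat) (hr : (3 <= r)%N) :
  (cvgn (max_density R r (pathg 3)) /\
   OPT R r (pathg 3) = 12 * ((r%:R - 1) / r%:R) ^+ 3)
  /\ turan_good r (pathg 3).
Proof.
split; last exact: turan_good_path3.
have c := @cvg_max_density R r hr.
(* Convergence is recorded because [limn] denotes a genuine limit only for convergent sequences. *)
split; first by apply/cvg_ex; eexists; exact: c.
exact: cvg_lim c.
Qed.
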